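(* Let $E/F$ be a cyclic (Galois) field extension of degree $n$, and let $\sigma$ be a generator of $\mathrm{Gal}(E/F)$. Suppose $y,z\in E$ satisfy $\mathrm{Tr}^E_F(y)=0$ and $\mathrm{Tr}^E_F(z)=1$. Then $y=\sigma x-x$ where $$x=\sum_{i=0}^{n-1}\left(\sum_{j=0}^{i-1}\sigma^j z\right)\sigma^i y .$$
   Context: A cyclic extension $E/F$ of degree $n$ is a finite Galois extension whose Galois group is cyclic of order $n$. The trace map is $\mathrm{Tr}^E_F(y)=\sum_{i=0}^{n-1}\sigma^i y$. An empty sum (the case $i=0$ of the inner sum) is $0$. *)

(* Defs.v *)
From mathcomp Require Import all_boot all_order all_algebra all_fingroup all_solvable all_field.
Set Implicit Arguments.
Unset Strict Implicit.
Unset Printing Implicit Defensive.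

Import GRing.Theory.
Local Open Scope ring_scope.

(* An extension E / K is a pair of intermediate fields of an ambient splitting
   field L; an abstract finite Galois extension L / F is the case K := 1,
   E := {:L}. *)
Definition cyclic_extension (F : fieldType) (L : splittingFieldType F)
    (K E : {subfield L}) (n : nat) : Prop :=
  [/\ galois K E, cyclic 'Gal(E / K)%g & #|'Gal(E / K)%g| = n].

(* Main.v *)
(* Put a_i = \sum_(j < i) sigma^j z and f_i = a_i * sigma^i y.  Since
   sigma a_i = a_(i+1) - z, applying sigma shifts the summands up to a
   correction: sigma f_i = f_(i+1) - z * sigma^(i+1) y.  Summing over i < n,
   sigma x - x telescopes to f_n - f_0 = Tr(z) * y, and the corrections add up
   to z * Tr(y) = 0. *)
Require Import Defs.
From mathcomp Require Import all_boot all_order all_algebra all_fingroup all_solvable all_field.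
Set Implicit Arguments.
Unset Strict Implicit.
Unset Printing Implicit Defensive.

Import GRing.Theory.
Local Open Scope ring_scope.

(** Exponents below [#[x]] enumerate the cycle without repetition, so the big operator can be
    reindexed along [x ^+ i]. *)
Lemma big_cycle (R : Type) (idx : R) (op : Monoid.com_law idx)
    (gT : finGroupType) (x : gT) (f : gT -> R) :
  \big[op/idx]_(g in <[x]>%g) f g = \big[op/idx]_(0 <= i < #[x]%g) f (x ^+ i)%g.
Proof.
rewrite big_mkord -(big_imset _ (A := predT) (h := fun i : 'I__ => (x ^+ i)%g)) /=.
  apply: eq_bigl => g; apply/idP/imsetP => [/cyclePmin[i ltix ->] | [i _ ->]].
    by exists (Ordinal ltix).
  exact: mem_cycle.
move=> i j _ _ /eqP; rewrite eq_expg_mod_order !modn_small // => eq_ij.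
exact/val_inj/eqP.
Qed.

Lemma galTrace_generator (F0 : fieldType) (L : splittingFieldType F0)
    (F E : {subfield L}) (sigma : gal_of E) (a : L) :
  generator 'Gal(E / F)%g sigma ->
  galTrace F E a = \sum_(0 <= i < #[sigma]%g) (sigma ^+ i)%g a.
Proof.
by move=> /eqP galE; rewrite /galTrace galE (big_cycle _ _ (fun g : gal_of E => g a)).
Qed.

Theorem theorem1p1 (F0 : fieldType) (L : splittingFieldType F0)
    (F E : {subfield L}) (n : nat) (sigma : gal_of E) (y z : L) :
  cyclic_extension F E n ->
  generator 'Gal(E / F)%g sigma ->
  y \in E -> z \in E ->
  galTrace F E y = 0 -> galTrace F E z = 1 ->
  let x := \sum_(0 <= i < n)
             (\sum_(0 <= j < i) (sigma ^+ j)%g z) * (sigma ^+ i)%g y in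
  y = sigma x - x.
Proof.
move=> [_ _ cardG] gen_sigma Ey Ez Try Trz; set x := \sum_(_ <= _ < _) _.
have ordn : #[sigma]%g = n by rewrite -cardG (eqP gen_sigma).
rewrite (galTrace_generator _ gen_sigma) ordn in Try.
rewrite (galTrace_generator _ gen_sigma) ordn in Trz.
(* Products in [gal_of E] are compositions on elements of [E], hence the membership condition. *)
have sigmaS i a : a \in E -> sigma ((sigma ^+ i)%g a) = (sigma ^+ i.+1)%g a.
  by move=> Ea; rewrite expgSr galM.
pose a_ i := \sum_(0 <= j < i) (sigma ^+ j)%g z.
pose f i := a_ i * (sigma ^+ i)%g y.
have sigma_a i : sigma (a_ i) = a_ i.+1 - z.
  (* The [j = 0] term of [a_ i.+1] is [z]; the remaining terms form [sigma (a_ i)]. *)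
  rewrite /a_ big_nat_recl // expg0 gal_id addrC addKr rmorph_sum.
  by apply: eq_bigr => j _; apply: sigmaS.
have sigma_f i : sigma (f i) - f i = f i.+1 - f i - z * sigma ((sigma ^+ i)%g y).
  by rewrite {1}/f rmorphM /= sigma_a sigmaS // mulrBl addrAC.
rewrite /x rmorph_sum -sumrB (eq_bigr _ (fun i _ => sigma_f i)) sumrB.
(* The corrections add up to [z] times [sigma] of the trace of [y], hence to 0. *)
rewrite telescope_sumr // -mulr_sumr -rmorph_sum Try rmorph0 mulr0 subr0.
(* In [f n], [a_ n] is the trace of [z] and [sigma ^+ n] is the identity; [f 0] vanishes because
   [a_ 0] is an empty sum. *)
by rewrite /f /a_ Trz mul1r big_geq // mul0r subr0 -ordn expg_order gal_id.
Qed.
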